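(* Let $A^{(1)}_{\mathbb Q}:=\{\frac{a+b}{ab}\mid a,b\in\mathbb Z\setminus\{0\}\}$. Then $$R^{(1)}=R^{(1)}_{\mathbb Q}=\Big\{\frac{a+b}{abc}\ \Big|\ a,b,c\in\mathbb Z\setminus\{0\}\Big\}=A^{(1)}_{\mathbb Q}.$$ Consequently, $\frac1r$ and $\frac2r$ are $1$-step relation numbers for any nonzero integer $r$.
   Context: For an integer sequence $\mathbf n=(n_1,n_2,\dots)$: $s^{\mathbf n}_0(t)=0$, $s^{\mathbf n}_1(t)=1$, $s^{\mathbf n}_{j+1}(t)=n_j\,t\,s^{\mathbf n}_j(t)-s^{\mathbf n}_{j-1}(t)$. For $l\ge 0$, $R^{(l)}$ is the set of $q\in\mathbb C$ such that $s^{\mathbf n}_{2m+2}(\sqrt{-q})=0$ for some integer $m\in[0,l]$ and some sequence $\mathbf n=(n_1,\dots,n_{2m+1})$ of nonzero integers (the choice of square root is irrelevant); note $0\in R^{(l)}$. Nonzero elements of $R^{(l)}$ are called $l$-step relation numbers. $R^{(l)}_{\mathbb Q}=R^{(l)}\cap\mathbb Q$. *)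

(* Defs.v *)
(* The field of complex numbers is R[i] for R : realType. *)
From mathcomp Require Import all_boot all_order all_algebra.
From mathcomp Require Import classical_sets reals complex.

Set Implicit Arguments.
Unset Strict Implicit.
Unset Printing Implicit Defensive.

Import Order.TTheory GRing.Theory Num.Theory.
Local Open Scope classical_set_scope.
Local Open Scope ring_scope.

(* [n j] is the j-th term of the sequence, numbered from 1: [n 0] is never
   used. [s_seq n j t] only depends on the terms n 1, ..., n (j - 1). *)
Fixpoint s_seq (C : comNzRingType) (n : nat -> int) (j : nat) (t : C) : C :=
  match j with
  | 0 => 0
  | 1 => 1
  | (i.+1 as k).+1 => (n k)%:~R * t * s_seq n k t - s_seq n i t
  end.

(* A finite sequence (n_1, ..., n_(2m+1)) of nonzero integers is encoded as an
   infinite one whose other terms are arbitrary. *)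
Definition relation_set (R : realType) (l : nat) : set R[i] :=
  [set q | exists m : nat, (m <= l)%N /\
     exists n : nat -> int,
       (forall j : nat, (1 <= j <= 2 * m + 1)%N -> n j != 0) /\
       s_seq n (2 * m + 2) (sqrtC (- q)) = 0].

Arguments relation_set R l : clear implicits.

Definition is_relation_number (R : realType) (l : nat) (q : R[i]) : Prop :=
  relation_set R l q /\ q != 0.

Definition relation_set_rat (R : realType) (l : nat) : set R[i] :=
  relation_set R l `&` range (ratr : rat -> R[i]).

Arguments relation_set_rat R l : clear implicits.

Definition A1_rat (R : realType) : set R[i] :=
  [set q | exists a b : int, [/\ a != 0, b != 0 &
     q = (a + b)%:~R / (a * b)%:~R]].

Arguments A1_rat R : clear implicits.

Lemma s_opp (C : comNzRingType) (n : nat -> int) (j : nat) (t : C) :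
  s_seq n j (- t) = (-1) ^+ j.+1 * s_seq n j t.
Proof.
suff [] : s_seq n j (- t) = (-1) ^+ j.+1 * s_seq n j t /\
  s_seq n j.+1 (- t) = (-1) ^+ j.+2 * s_seq n j.+1 t by [].
elim: j => [|j [IH1 IH2]]; first by rewrite /= mulr0 expr2 mulrNN !mulr1.
split=> //; rewrite [LHS]/= -/(s_seq n j.+1 (- t)) IH1 IH2.
rewrite [in RHS]/= -/(s_seq n j.+1 t) mulrBr !exprS !mulN1r !opprK.
by rewrite !mulNr !mulrN ?mulNr !opprK mulrCA.
Qed.

(* The choice of square root is irrelevant. *)
Lemma s_sqrt_irrelevant (C : numClosedFieldType) (n : nat -> int) (j : nat)
  (q t : C) : t ^+ 2 = - q -> (s_seq n j (sqrtC (- q)) = 0) <-> (s_seq n j t = 0).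
Proof.
move=> tq; have /eqP : sqrtC (- q) ^+ 2 = t ^+ 2 by rewrite sqrtCK tq.
rewrite eqf_sqr => /orP[] /eqP -> //; rewrite s_opp; split; last first.
  by move=> ->; rewrite mulr0.
by move/eqP; rewrite mulf_eq0 signr_eq0 => /eqP.
Qed.

(* Main.v *)
Require Import Defs.
From mathcomp Require Import all_boot all_order all_algebra.
From mathcomp Require Import classical_sets reals complex ring.

Set Implicit Arguments.
Unset Strict Implicit.
Unset Printing Implicit Defensive.

Import Order.TTheory GRing.Theory Num.Theory.
Local Open Scope classical_set_scope.
Local Open Scope ring_scope.

(** For [l = 1] only [s_2 = n_1 t] and [s_4 = t (n_1 n_2 n_3 t^2 - (n_1 + n_3))] matter. Putting
    [t^2 = -q], a root is either [q = 0] or [q = -(n_1 + n_3) / (n_1 n_2 n_3)], and all such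
    fractions occur; this is [relation_set1E]. These numbers are visibly rational, and the third
    parameter [c] is absorbed by scaling [a] and [b] by it, which gives [A1_rat]. *)

Lemma s_seq2E (C : comNzRingType) (n : nat -> int) (t : C) :
  s_seq n 2 t = (n 1%N)%:~R * t.
Proof. by rewrite /= mulr1 subr0. Qed.

(** The factored form separates the root [t = 0] from a factor that is linear in [t ^+ 2], so only
    [- q] enters it and not its square root. *)
Lemma s_seq4E (C : comNzRingType) (n : nat -> int) (t : C) :
  s_seq n 4 t =
  t * ((n 1 * n 2 * n 3)%:~R * t ^+ 2 - (n 1 + n 3)%:~R).
Proof. by rewrite /= intrD !intrM; ring. Qed.

Lemma relation_set1E (R : realType) :
  relation_set R 1 =
  [set q : R[i] | exists a b c : int, [/\ a != 0, b != 0, c != 0 &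
     q = (a + b)%:~R / (a * b * c)%:~R]].
Proof.
apply/seteqP; split=>
  [q [m [m_le1 [n [n_neq0 sq0]]]]|q [a [b [c [a0 b0 c0 ->]]]]].
(* The factor [t] can vanish both for [m = 0] and for [m = 1]; it gives [q = 0], which is
   [(1 - 1) / (1 * (-1) * 1)]. *)
- have q0P : sqrtC (- q) = 0 -> exists a b c : int,
      [/\ a != 0, b != 0, c != 0 & q = (a + b)%:~R / (a * b * c)%:~R].
    move=> /eqP; rewrite sqrtC_eq0 oppr_eq0 => /eqP ->.
    by exists 1, (-1), 1; split=> //; rewrite subrr mul0r.
  case: m m_le1 n_neq0 sq0 => [|[|//]] _ n_neq0.
    rewrite s_seq2E => /eqP; rewrite mulf_eq0 intr_eq0 (negPf (n_neq0 1%N _)) //=.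
    by move=> /eqP.
  have [[n1 n2] n3] := (n_neq0 1%N isT, n_neq0 2%N isT, n_neq0 3%N isT).
  rewrite s_seq4E sqrtCK => /eqP; rewrite mulf_eq0 => /orP[/eqP //|].
  rewrite subr_eq0 => /eqP eq_q.
  (* The sign from [t^2 = -q] is moved into the middle term. *)
  exists (n 1%N), (n 3%N), (- n 2%N); split; rewrite ?oppr_eq0 //.
  apply: canRL (mulfK _) _; first by rewrite intr_eq0 !mulf_neq0 ?oppr_eq0.
  by rewrite -eq_q !intrM intrN; ring.
- exists 1%N; split=> //.
  (* The sequence [(a, -c, b)], inverting the choice above; its tail is filled with [b]. *)
  exists (fun j => if j == 1%N then a else if j == 2%N then - c else b); split.
    by move=> j _; do 2![case: ifP => _ //]; rewrite oppr_eq0.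
  rewrite s_seq4E sqrtCK /=.
  have -> : a * - c * b = - (a * b * c) by ring.
  by rewrite intrN mulrNN mulrCA divff ?mulr1 ?subrr ?mulr0 //
    intr_eq0 !mulf_neq0.
Qed.

Theorem proposition4p3 (R : realType) :
  [/\ relation_set R 1 = relation_set_rat R 1,
      relation_set_rat R 1 =
        [set q : R[i] | exists a b c : int, [/\ a != 0, b != 0, c != 0 &
           q = (a + b)%:~R / (a * b * c)%:~R]],
      [set q : R[i] | exists a b c : int, [/\ a != 0, b != 0, c != 0 &
         q = (a + b)%:~R / (a * b * c)%:~R]] = A1_rat R
    & forall r : int, r != 0 ->
        is_relation_number 1 (1 / r%:~R : R[i]) /\
        is_relation_number 1 (2 / r%:~R : R[i])].
Proof.
have rat1 : relation_set R 1 = relation_set_rat R 1.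
  apply/esym/setIidPl; rewrite relation_set1E => _ [a [b [c [_ _ _ ->]]]].
  by exists ((a + b)%:~R / (a * b * c)%:~R) => //;
    rewrite fmorph_div /= !ratr_int.
split=> //; first by rewrite -rat1 relation_set1E.
- apply/seteqP; split=> [_ [a [b [c [a0 b0 c0 ->]]]]|_ [a [b [a0 b0 ->]]]].
    (* One factor [c] cancels in [(ac + bc) / (ac * bc)]. *)
    exists (a * c), (b * c); split; rewrite ?mulf_neq0 //.
    apply/eqP; rewrite eqr_div ?intr_eq0 ?mulf_neq0 // -!intrM.
    by apply/eqP; congr (_%:~R); ring.
  by exists a, b, 1; split=> //; rewrite mulr1.
- have two_over (r : int) : r != 0 -> is_relation_number 1 (2 / r%:~R : R[i]).
    move=> r0; split; last by rewrite mulf_neq0 ?invr_eq0 ?intr_eq0 ?pnatr_eq0.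
    by rewrite relation_set1E; exists 1, 1, r; split=> //; rewrite !mul1r.
  move=> r r0; split; last exact: two_over.
  (* Since [1 / r = 2 / (2r)], this case reduces to [two_over] at [2r]. *)
  have r2_neq0 : r *+ 2 != 0 by rewrite mulrn_eq0.
  suff -> : 1 / r%:~R = 2 / (r *+ 2)%:~R :> R[i] by exact: two_over.
  apply/eqP; rewrite eqr_div ?intr_eq0 // mul1r.
  by rewrite (rmorphMn (intmul 1)) mulr_natl.
Qed.
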